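(* For every $x\in I$, the limit $h_0(x):=\lim_{q\downarrow0}h_q(x)$ exists and is given by $$h_0(x)=s(x)-g(x)=x-g(x),\qquad g(x)=\pi_0\int_0^xm(y)\,dy$$ (with $g=0$ if $\pi_0=0$). The function $h_0$ is continuous and increasing on $I$, positive on $I\setminus\{0\}$, and zero at $x=0$. In particular, if $\pi_0=0$, then $h_0$ coincides with the scale function, i.e. $h_0(x)=s(x)=x$.
   Context: Setting. Let $m:[0,\infty)\to[0,\infty]$ be non-decreasing and right-continuous with $m(0)=0$, and suppose there are $0<l'\le l\le\infty$ such that $m$ is strictly increasing (and finite) on $[0,l')$, flat and finite on $[l',l)$, and infinite on $[l,\infty)$. The scale is $s(x)=x$. Fix $0<c<l'$ and put $F_1=\iint_{l'>y>x>c}dm(x)\,dy$, $F_2=\iint_{l'>y>x>c}dx\,dm(y)$ (with $m$ restricted to $(0,l')$). The boundary $l'$ is called regular if $F_1,F_2<\infty$; exit if $F_1<\infty=F_2$; entrance if $F_1=\infty>F_2$; natural if $F_1=F_2=\infty$. If regular it is regular-reflecting if $l'<l=\infty$ (then $I'=I=[0,l']$), regular-elastic if $l'<l<\infty$ (then $I'=[0,l']$, $I=[0,l']\cup\{l\}$), regular-absorbing if $l'=l<\infty$ (then $I'=[0,l)$, $I=[0,l]$). If exit, $l'=l<\infty$, $I'=[0,l)$, $I=[0,l]$. If entrance, $l'=l=\infty$, $I'=I=[0,\infty)$. If natural, $l'=l\le\infty$, $I'=I=[0,l)$. Resolvent density. For $q>0$ let $\phi_q,\psi_q$ on $[0,l)$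 solve $\phi_q=1+qJ\phi_q$, $\psi_q=s+qJ\psi_q$, where $Jf(x)=\int_0^xdy\int_{(0,y]}f(z)\,dm(z)$; put $H(q)=\lim_{x\uparrow l}\psi_q(x)/\phi_q(x)$, $\rho_q=\phi_q-\psi_q/H(q)$, and $r_q(x,y)=r_q(y,x)=H(q)\phi_q(x)\rho_q(y)$ for $0\le x\le y$, $x,y\in I'$; in particular $r_q(0,0)=H(q)$, $r_q(x,0)=H(q)\rho_q(x)$ for $x\in I'$. If $l\in I$, put $r_q(l,0)=0$. (These are resolvent densities of the $D_mD_s$-generalized diffusion on $I$ with $0$ regular-reflecting.) Set $h_q(x)=r_q(0,0)-r_q(x,0)$ for $q>0$, $x\in I$, and $\pi_0=\lim_{q\downarrow0}qH(q)=1/m(\infty)\in[0,\infty)$, where $m(\infty)=\lim_{x\to\infty}m(x)$ and $1/\infty=0$ (so $\pi_0=0$ whenever $l<\infty$). *)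

(* Defs.v *)
From HB Require Import structures.
From mathcomp Require Import all_boot all_order all_algebra.
From mathcomp Require Import all_classical all_reals all_analysis.
Import Order.TTheory GRing.Theory Num.Theory.
Import numFieldNormedType.Exports.

Set Implicit Arguments.
Unset Strict Implicit.
Unset Printing Implicit Defensive.

Local Open Scope classical_set_scope.
Local Open Scope ring_scope.

Section diffusion.
Variable R : realType.

(* m is only constrained on [0, +oo[; the variable l1 stands for l'. *)
Record is_string (m : R -> \bar R) (l1 l : \bar R) : Prop := IsString {
  string_ge0 : forall x, 0 <= x -> (0 <= m x)%E ;
  string_nondecreasing : forall x y, 0 <= x -> x <= y -> (m x <= m y)%E ;
  string_right_continuous : forall x, 0 <= x -> m y @[y --> x^'+] --> m x ;
  string_at0 : m 0 = 0%E ;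
  string_l1_gt0 : (0 < l1)%E ;
  string_l1_le_l : (l1 <= l)%E ;
  string_finite : forall x, 0 <= x -> (x%:E < l)%E -> (m x < +oo)%E ;
  string_increasing : forall x y, 0 <= x -> x < y -> (y%:E < l1)%E ->
    (m x < m y)%E ;
  string_flat : forall x y, (l1 <= x%:E)%E -> (x%:E < l)%E ->
    (l1 <= y%:E)%E -> (y%:E < l)%E -> m x = m y ;
  string_infinite : forall x, (l <= x%:E)%E -> m x = +oo%E }.

(* m need not be real-valued, so the Stieltjes measure dm is specified by its
   values on half-open intervals; this determines it on the Borel subsets of
   ]0, l[, which is where it is integrated. *)
Definition is_stieltjes (m : R -> \bar R) (l : \bar R)
    (dm : {measure set (measurableTypeR R) -> \bar R}) : Prop :=
  forall a b : R, 0 <= a -> a <= b -> (b%:E < l)%E ->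
    dm `]a, b]%classic = (m b - m a)%E.

Definition scale (x : R) : R := x.

Variables (m : R -> \bar R) (dm : {measure set (measurableTypeR R) -> \bar R}).
Variables (l1 l : \bar R) (c : R).

(* F1 and F2 as iterated integrals, the inner one over the x-section ]c, y[ *)
Definition F1 : \bar R :=
  (\int[lebesgue_measure]_(y in [set y : R | (c < y)%R /\ (y%:E < l1)%E])
     dm `]c, y[%classic)%E.

Definition F2 : \bar R :=
  (\int[dm]_(y in [set y : R | (c < y)%R /\ (y%:E < l1)%E])
     lebesgue_measure `]c, y[%classic)%E.

Variant boundary_type : Type :=
  | RegularReflecting | RegularElastic | RegularAbsorbing
  | Exit | Entrance | Natural.

Definition boundary : boundary_type :=
  if (F1 < +oo)%E then
    if (F2 < +oo)%E then
      if (l1 < l)%E then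
        if l == +oo%E then RegularReflecting else RegularElastic
      else RegularAbsorbing
    else Exit
  else if (F2 < +oo)%E then Entrance else Natural.

(* the interval I' *)
Definition inner_space : set R :=
  match boundary with
  | RegularReflecting | RegularElastic => [set x | 0 <= x /\ (x%:E <= l1)%E]
  | RegularAbsorbing | Exit | Natural => [set x | 0 <= x /\ (x%:E < l)%E]
  | Entrance => [set x | 0 <= x]
  end.

(* the state space I *)
Definition state_space : set R :=
  match boundary with
  | RegularReflecting => [set x | 0 <= x /\ (x%:E <= l1)%E]
  | RegularElastic => [set x | (0 <= x /\ (x%:E <= l1)%E) \/ x%:E = l]
  | RegularAbsorbing | Exit => [set x | 0 <= x /\ (x%:E <= l)%E]
  | Entrance => [set x | 0 <= x]
  | Natural => [set x | 0 <= x /\ (x%:E < l)%E]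
  end.

Definition J (f : R -> R) (x : R) : R :=
  \int[lebesgue_measure]_(y in `[0, x]) \int[dm]_(z in `]0, y]) f z.

(* f solves f = f0 + q J f on [0, l[; local dm-integrability is what makes
   J f meaningful there. *)
Definition solves (f0 : R -> R) (q : R) (f : R -> R) : Prop :=
  (forall y, 0 <= y -> (y%:E < l)%E -> dm.-integrable `]0, y] (EFin \o f)) /\
  (forall x, 0 <= x -> (x%:E < l)%E -> f x = f0 x + q * J f x).

Variables phi psi : R -> R -> R.

Definition H (q : R) : R :=
  match l with
  | b%:E => lim (psi q x / phi q x @[x --> b^'-])
  | _ => lim (psi q x / phi q x @[x --> +oo])
  end.

Definition rho (q x : R) : R := phi q x - psi q x / H q.

(* The value 0 outside I' x I' provides r_q(l, 0) = 0 when l belongs to I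
   (l is never in I' in that case). *)
Definition resolvent (q x y : R) : R :=
  if (x \in inner_space) && (y \in inner_space)
  then H q * phi q (Num.min x y) * rho q (Num.max x y)
  else 0.

Definition h (q x : R) : R := resolvent q 0 0 - resolvent q x 0.

Definition h0 (x : R) : R := lim (h q x @[q --> 0^'+]).

(* 1 / m(oo), with 1 / oo = 0 *)
Definition pi0 : R :=
  match lim (m x @[x --> +oo]) with
  | r%:E => r^-1
  | _ => 0
  end.

(* If pi0 <> 0 then m is finite on [0, +oo[, so that fine loses nothing. *)
Definition g (x : R) : R :=
  if pi0 == 0 then 0
  else pi0 * \int[lebesgue_measure]_(y in `[0, x]) fine (m y).

End diffusion.

(* Main.v *)
(* Since [phi 0 = 1] and [psi 0 = 0], on [I'] one has
   [h_q = psi_q - q H(q) J phi_q], so the limit follows from [psi_q x -> x],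
   [J phi_q x -> J 1 x = int_0^x m] and [q H(q) -> pi_0]; at an end point
   [l] of [I] outside [I'] one has [h_q l = H(q)], and [H(q) -> l].

   All estimates come from a minimum principle for [f >= q J f]: applied to
   suitable combinations of [1], [phi_q] and [psi_q] it gives
   [q m(a) psi_q <= (1 + q a m(a)) phi_q] and [phi_q - 1 <= q m(oo) psi_q],
   hence [1 / m(oo) <= q H(q) <= 1 / m(a) + q a] when [l = oo], and
   [x / phi_q x <= H(q) <= l] when [l < oo].  Its two-sided form also shows,
   without the Wronskian, that [psi_q / phi_q] is non-decreasing, so that the
   limit defining [H(q)] exists. *)

Require Import Defs.
From HB Require Import structures.
From mathcomp Require Import all_boot all_order all_algebra.
From mathcomp Require Import all_classical all_reals all_analysis.
From mathcomp Require Import measurable_realfun ring lra.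
Import Order.TTheory GRing.Theory Num.Theory.
Import numFieldNormedType.Exports.

Local Open Scope classical_set_scope.
Local Open Scope ring_scope.

(** The sets where [r <= f] are up-closed in the interval [D], hence themselves intervals, and the
    rays [[r, +oo]] generate the Borel sets. *)
Lemma nondecreasing_emeasurable (R : realType) (D : set R) (f : R -> \bar R) :
  is_interval D -> {in D &, {homo f : x y / x <= y >-> (x <= y)%E}} ->
  measurable_fun D f.
Proof.
move=> iD fnd.
apply: (measurability (@ErealGenCInfty.G R)).
  exact: ErealGenCInfty.measurableE.
move=> /= _ [_ [r ->] <-]; apply: is_interval_measurable => s t /= [Ds fs] [Dt _] u.
move=> /andP[su ut]; have Du : D u by apply: (iD s t) => //; rewrite su.
split => //; move: fs; rewrite /= !in_itv/= !andbT => /le_trans; apply.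
by apply: fnd => //; exact: mem_set.
Qed.

(** * The operators [f |-> int_(0,y] f dm] and [J] *)

Section stieltjes_operators.
Context (R : realType) (m : R -> \bar R).
Context (dm : {measure set (measurableTypeR R) -> \bar R}) (l1 l : \bar R).
Hypotheses (m_string : is_string m l1 l) (dm_stieltjes : is_stieltjes m l dm).
Implicit Types (f : R -> R) (a b x y : R).

(** Since [fine] sends [+oo] to [0], this stands for [m] only below [l], which is why bounds by [l]
    accompany it. *)
Definition mass x := fine (m x).

Definition integral_upto f y : R := \int[dm]_(z in `]0, y]) f z.

Definition loc_integrable f := forall y, 0 <= y -> (y%:E < l)%E ->
  dm.-integrable `]0, y] (EFin \o f).

Local Notation G := integral_upto.
Local Notation J := (J dm).

Lemma massE x : 0 <= x -> (x%:E < l)%E -> m x = (mass x)%:E.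
Proof.
move=> x0 xl; rewrite /mass fineK// fin_numElt (string_finite m_string)// andbT.
by rewrite (lt_le_trans _ (string_ge0 m_string _))// ltNy0.
Qed.

Lemma lt_le_l {x y} : x <= y -> (y%:E < l)%E -> (x%:E < l)%E.
Proof. by move=> xy; apply: le_lt_trans; rewrite lee_fin. Qed.

Lemma mass_ge0 x : 0 <= x -> 0 <= mass x.
Proof. by move=> x0; rewrite /mass fine_ge0// (string_ge0 m_string). Qed.

Lemma mass_le x y : 0 <= x -> x <= y -> (y%:E < l)%E -> mass x <= mass y.
Proof.
move=> x0 xy yl; rewrite -lee_fin -!massE ?(le_trans x0)//.
  exact: (string_nondecreasing m_string).
exact: lt_le_l yl.
Qed.

Lemma mass0 : mass 0 = 0.
Proof. by rewrite /mass (string_at0 m_string). Qed.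

Lemma dm_itv a b : 0 <= a -> a <= b -> (b%:E < l)%E ->
  dm `]a, b]%classic = (mass b - mass a)%:E.
Proof.
move=> a0 ab bl; rewrite dm_stieltjes// massE// ?(le_trans a0)// massE//.
exact: lt_le_l bl.
Qed.

Lemma l_gt0 : (0%:E < l)%E.
Proof. exact: lt_le_trans (string_l1_gt0 m_string) (string_l1_le_l m_string). Qed.

Lemma loc_integrable_itv {f a b} : loc_integrable f -> 0 <= a ->
  0 <= b -> (b%:E < l)%E -> dm.-integrable `]a, b] (EFin \o f).
Proof.
move=> If a0 b0 bl; apply: integrableS (If b b0 bl) => //.
by move=> z /=; rewrite !in_itv/= => /andP[az ->]; rewrite (le_lt_trans a0).
Qed.

Lemma integral_upto_itv f a b : loc_integrable f -> 0 <= a -> a <= b ->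
  (b%:E < l)%E -> G f b - G f a = \int[dm]_(z in `]a, b]) f z.
Proof.
move=> If a0 ab bl.
have E : `]0, b]%classic = `]0, a]%classic `|` `]a, b]%classic :> set R.
  apply/seteqP; split=> z /=; rewrite !in_itv/=.
    by move=> /andP[z0 zb]; rewrite z0 zb andbT/=; case: (leP z a); [left|right].
  by case=> /andP[u v]; rewrite ?u ?v ?(le_trans v)// ?(le_lt_trans a0)//.
rewrite /integral_upto E Rintegral_setU//.
- by rewrite addrAC subrr add0r.
- by rewrite -E; apply: If; rewrite ?(le_trans a0).
- apply/disj_setPRL => z /=; rewrite !in_itv/= => /andP[az _] /andP[_ za].
  by move: (lt_le_trans az za); rewrite ltxx.
Qed.

Lemma integral_upto0 f : G f 0 = 0.
Proof. by rewrite /integral_upto set_itv_ge ?Rintegral_set0// bnd_simp ltxx. Qed.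

Lemma loc_integrable_cst k : loc_integrable (cst k).
Proof.
move=> y y0 yl; apply: measurable_bounded_integrable => //.
  by rewrite dm_itv// ltry.
by exists `|k|; split => // M kM z _ /=; exact: ltW.
Qed.

Lemma loc_integrableZ f k : loc_integrable f -> loc_integrable (fun z => k * f z).
Proof.
move=> If y y0 yl.
rewrite (_ : EFin \o _ = (fun z => k%:E * (EFin \o f) z)%E)//.
by apply: integrableZl => //; exact: If.
Qed.

Lemma loc_integrableD f f' k : loc_integrable f -> loc_integrable f' ->
  loc_integrable (fun z => f z + k * f' z).
Proof.
move=> If If' y y0 yl.
rewrite (_ : EFin \o _ = ((EFin \o f) \+ (EFin \o (fun z => k * f' z)%R))%E)//.
by apply: integrableD => //; [exact: If|exact: loc_integrableZ].
Qed.

Lemma integral_uptoD f f' k y : loc_integrable f -> loc_integrable f' ->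
  0 <= y -> (y%:E < l)%E ->
  G (fun z => f z + k * f' z) y = G f y + k * G f' y.
Proof.
move=> If If' y0 yl; rewrite /integral_upto RintegralD ?RintegralZl//.
- exact: If'.
- exact: If.
- exact: loc_integrableZ.
Qed.

Lemma integral_upto_ge f k a b : loc_integrable f -> 0 <= a -> a <= b ->
  (b%:E < l)%E -> (forall z, a < z -> z <= b -> k <= f z) ->
  k * (mass b - mass a) <= G f b - G f a.
Proof.
move=> If a0 ab bl kf; have b0 := le_trans a0 ab.
rewrite integral_upto_itv//.
rewrite (_ : mass b - mass a = fine (dm `]a, b]%classic)); last by rewrite dm_itv.
rewrite -Rintegral_cst//; apply: le_Rintegral => //.
- exact: (loc_integrable_itv (loc_integrable_cst k)).
- exact: loc_integrable_itv.
- by move=> z /=; rewrite in_itv/= => /andP[]; exact: kf.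
Qed.

Lemma integral_upto1 y : 0 <= y -> (y%:E < l)%E -> G (cst 1) y = mass y.
Proof.
by move=> y0 yl; rewrite /integral_upto Rintegral_cst// mul1r dm_itv// mass0 subr0.
Qed.

Lemma integral_upto_le f a b : loc_integrable f -> 0 <= a -> a <= b ->
  (b%:E < l)%E -> (forall z, a < z -> z <= b -> 0 <= f z) -> G f a <= G f b.
Proof.
move=> If a0 ab bl f0.
by have := @integral_upto_ge f 0 a b If a0 ab bl f0; rewrite mul0r subr_ge0.
Qed.

Lemma loc_integrable_norm f : loc_integrable f -> loc_integrable (fun z => `|f z|).
Proof. by move=> If y y0 yl; apply: integrable_norm; exact: If. Qed.

Lemma norm_integral_upto f a b : loc_integrable f -> 0 <= a -> a <= b ->
  (b%:E < l)%E -> `|G f a| <= G (fun z => `|f z|) b.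
Proof.
move=> If a0 ab bl.
apply: (@le_trans _ _ (G (fun z => `|f z|) a)).
  by apply: le_normr_Rintegral => //; apply: If => //; exact: lt_le_l bl.
by apply: integral_upto_le => //; exact: loc_integrable_norm.
Qed.

(** Writing [f = (f + |f|) - |f|] makes [G f] a difference of two non-decreasing functions. *)
Lemma measurable_integral_upto f b : loc_integrable f -> (b%:E < l)%E ->
  measurable_fun `[0, b] (G f).
Proof.
move=> If bl.
have mono g : loc_integrable g -> (forall z, 0 <= g z) ->
    measurable_fun `[0, b] (G g).
  move=> Ig g0; apply/measurable_EFinP; apply: nondecreasing_emeasurable.
    exact: interval_is_interval.
  move=> x y; rewrite !inE/= !in_itv/= => /andP[x0 _] /andP[_ yb] xy.
  by rewrite lee_fin; apply: integral_upto_le => //; exact: lt_le_l bl.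
have In := loc_integrable_norm _ If.
have Ip := loc_integrableD _ _ 1 If In.
apply: (eq_measurable_fun (fun y => G (fun z => f z + 1 * `|f z|) y
    - G (fun z => `|f z|) y)) => [y|].
  rewrite inE/= in_itv/= => /andP[y0 yb].
  have -> := integral_uptoD f (fun z => `|f z|) 1 y If In y0 (lt_le_l yb bl).
  by rewrite mul1r addrK.
apply: measurable_funB; apply: mono => // z.
by rewrite mul1r -lerBlDl sub0r -normrN ler_norm.
Qed.

Lemma integrable_integral_upto f b : loc_integrable f -> 0 <= b ->
  (b%:E < l)%E -> lebesgue_measure.-integrable `[0, b] (EFin \o G f).
Proof.
move=> If b0 bl; apply: measurable_bounded_integrable => //.
- by rewrite /= lebesgue_measure_itv/=; case: ifP => _; rewrite ?ltry// -EFinB ltry.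
- exact: measurable_integral_upto.
- exists (G (fun z => `|f z|) b); split; first exact: num_real.
  move=> M kM y /=; rewrite in_itv/= => /andP[y0 yb].
  by apply: le_trans (ltW kM); exact: norm_integral_upto.
Qed.

Lemma J_itv f a b : loc_integrable f -> 0 <= a -> a <= b -> (b%:E < l)%E ->
  J f b - J f a = \int[lebesgue_measure]_(y in `]a, b]) G f y.
Proof.
move=> If a0 ab bl; apply: Rintegral_itvB; rewrite ?bnd_simp//.
by apply: integrable_integral_upto => //; exact: le_trans ab.
Qed.

Lemma lebesgue_itvoc a b : a <= b -> fine (lebesgue_measure `]a, b]%classic) = b - a.
Proof.
move=> ab; rewrite /= lebesgue_measure_itv/= lte_fin; case: ltgtP ab => //= -> _.
by rewrite subrr.
Qed.

Lemma integrable_integral_upto_itv f a b : loc_integrable f -> 0 <= a ->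
  a <= b -> (b%:E < l)%E ->
  lebesgue_measure.-integrable `]a, b] (EFin \o G f).
Proof.
move=> If a0 ab bl; have b0 := le_trans a0 ab.
apply: integrableS (integrable_integral_upto f b If b0 bl) => //.
by move=> z /=; rewrite !in_itv/= => /andP[az ->]; rewrite (le_trans a0)// ltW.
Qed.

Lemma integrable_cst_itv (k a b : R) :
  lebesgue_measure.-integrable `]a, b]%classic (EFin \o cst k).
Proof.
apply: measurable_bounded_integrable => //.
  by rewrite /= lebesgue_measure_itv/=; case: ifP => _; rewrite ?ltry// -EFinB ltry.
by exists `|k|; split => // M kM z _ /=; exact: ltW.
Qed.

Lemma J_ge f k a b : loc_integrable f -> 0 <= a -> a <= b -> (b%:E < l)%E ->
  (forall y, a <= y -> y <= b -> k <= G f y) -> k * (b - a) <= J f b - J f a.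
Proof.
move=> If a0 ab bl kG; rewrite J_itv// -(lebesgue_itvoc a b ab) -Rintegral_cst//.
apply: le_Rintegral => //.
- exact: integrable_cst_itv.
- exact: integrable_integral_upto_itv.
- by move=> y /=; rewrite in_itv/= => /andP[/ltW ay yb]; exact: kG.
Qed.

Lemma J_le f k a b : loc_integrable f -> 0 <= a -> a <= b -> (b%:E < l)%E ->
  (forall y, a <= y -> y <= b -> G f y <= k) -> J f b - J f a <= k * (b - a).
Proof.
move=> If a0 ab bl kG; rewrite J_itv// -(lebesgue_itvoc a b ab) -Rintegral_cst//.
apply: le_Rintegral => //.
- exact: integrable_integral_upto_itv.
- exact: integrable_cst_itv.
- by move=> y /=; rewrite in_itv/= => /andP[/ltW ay yb]; exact: kG.
Qed.

Lemma J0 f : J f 0 = 0.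
Proof. by rewrite /Defs.J set_itv1 Rintegral_set1. Qed.

Lemma JD f f' k x : loc_integrable f -> loc_integrable f' ->
  0 <= x -> (x%:E < l)%E ->
  J (fun z => f z + k * f' z) x = J f x + k * J f' x.
Proof.
move=> If If' x0 xl.
rewrite /Defs.J -!/(G _ _) -RintegralZl//; last exact: integrable_integral_upto.
rewrite -RintegralD//; last 2 first.
- exact: integrable_integral_upto.
- rewrite (_ : EFin \o _ = (fun z => k%:E * (EFin \o G f') z)%E)//.
  by apply: integrableZl => //; exact: integrable_integral_upto.
apply: eq_Rintegral => y; rewrite inE/= in_itv/= => /andP[y0 yx].
by apply: integral_uptoD => //; exact: lt_le_l xl.
Qed.

Lemma J_mono f f' x : loc_integrable f -> loc_integrable f' -> 0 <= x ->
  (x%:E < l)%E -> (forall z, 0 < z -> z <= x -> f z <= f' z) -> J f x <= J f' x.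
Proof.
move=> If If' x0 xl ff'; have := JD f' f (-1) x If' If x0 xl.
suff : 0 <= J (fun z => f' z + -1 * f z) x by lra.
have ID := loc_integrableD f' f (-1) If' If.
have := @J_ge _ 0 0 x ID (lexx _) x0 xl; rewrite mul0r J0 subr0; apply => y y0 yx.
have := @integral_upto_le _ 0 y ID (lexx _) y0 (lt_le_l yx xl).
rewrite integral_upto0; apply => z z0 zy.
by have := ff' z z0 (le_trans zy yx); lra.
Qed.

Lemma J_cst k x : 0 <= x -> (x%:E < l)%E -> J (cst k) x = k * J (cst 1) x.
Proof.
move=> x0 xl; have I1 := loc_integrable_cst 1; have I0 := loc_integrable_cst 0.
have := JD (cst 0) (cst 1) k x I0 I1 x0 xl.
(* This instance reads [J (cst 0) x = J (cst 0) x - J (cst 0) x], so that [J (cst 0) x = 0]. *)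
have := JD (cst 0) (cst 0) (-1) x I0 I0 x0 xl.
rewrite (_ : (fun z : R => (cst 0 z : R) + -1 * cst 0 z) = cst 0); last first.
  by apply/funext => z /=; rewrite mulr0 addr0.
rewrite (_ : (fun z : R => (cst 0 z : R) + k * cst 1 z) = cst k); last first.
  by apply/funext => z /=; rewrite mulr1 add0r.
by move=> + -> ; lra.
Qed.

Lemma J_ge0_le f a b : loc_integrable f -> 0 <= a -> a <= b -> (b%:E < l)%E ->
  (forall z, 0 < z -> z <= b -> 0 <= f z) -> J f a <= J f b.
Proof.
move=> If a0 ab bl f0.
rewrite -subr_ge0 -(mul0r (b - a)); apply: J_ge => // y ay yb.
have y0 := le_trans a0 ay.
rewrite -(integral_upto0 f); apply: integral_upto_le => //.
  exact: lt_le_l bl.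
by move=> z z0 zy; apply: f0 => //; exact: le_trans yb.
Qed.

(** Supplies the a priori lower bound from which the halving in the minimum principle starts. *)
Lemma J_bounded f b : loc_integrable f -> 0 <= b -> (b%:E < l)%E ->
  exists B, forall x, 0 <= x -> x <= b -> `|J f x| <= B.
Proof.
move=> If b0 bl; set k := G (fun z => `|f z|) b; exists (k * b) => x x0 xb.
have xl := lt_le_l xb bl.
have Gk y : 0 <= y -> y <= x -> `|G f y| <= k.
  by move=> y0 yx; apply: norm_integral_upto => //; exact: le_trans xb.
have k0 : 0 <= k by apply: le_trans (Gk 0 _ _).
have kx : k * x <= k * b by rewrite ler_wpM2l.
have := @J_ge f (- k) 0 x If (lexx _) x0 xl.
have := @J_le f k 0 x If (lexx _) x0 xl.
rewrite J0 !subr0 mulNr ler_norml => h1 h2; apply/andP; split.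
  rewrite (le_trans _ (h2 _)) ?lerN2// => y y0 yx.
  by have := Gk y y0 yx; rewrite ler_norml => /andP[].
rewrite (le_trans (h1 _))// => y y0 yx.
by have := Gk y y0 yx; rewrite ler_norml => /andP[].
Qed.

(** * Minimum principle *)

(** As [J f] is the integral of [G f], the right-hand side is the first-order Taylor remainder at
    [t]. On [[t, s]] the sign of [f] keeps [G f] above [G f t]; on [[s, x]] it loses at most
    [A * mass b]. *)
Lemma J_taylor_ge_right f A b t s x : loc_integrable f -> 0 <= A ->
  (b%:E < l)%E -> 0 <= t -> t <= s -> s <= x -> x <= b ->
  (forall z, t <= z -> z <= s -> 0 <= f z) ->
  (forall z, t <= z -> z <= x -> - A <= f z) ->
  - (A * mass b * (x - s)) <= J f x - J f t - (x - t) * G f t.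
Proof.
move=> If A0 bl t0 ts sx xb f0 fA.
have s0 := le_trans t0 ts; have xl := lt_le_l xb bl.
have sl := lt_le_l sx xl.
have Gt y : t <= y -> y <= s -> G f t <= G f y.
  move=> ty ys; apply: integral_upto_le => //; first exact: lt_le_l sl.
  by move=> z /ltW tz zy; apply: f0 => //; exact: le_trans ys.
have J1 := @J_ge f (G f t) t s If t0 ts sl Gt.
have J2 : (G f t - A * mass b) * (x - s) <= J f x - J f s.
  apply: J_ge => // y sy yx; have y0 := le_trans s0 sy.
  have yl := lt_le_l yx xl.
  have H1 : - A * (mass y - mass s) <= G f y - G f s.
    apply: integral_upto_ge => // z /ltW sz zy.
    by apply: fA; [exact: le_trans sz|exact: le_trans yx].
  have H2 : mass y <= mass b by apply: mass_le => //; exact: le_trans xb.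
  have H3 := mass_ge0 s s0.
  have H4 := Gt s ts (lexx _).
  have H5 : A * (mass y - mass s) <= A * mass b by apply: ler_wpM2l; lra.
  lra.
lra.
Qed.

(** Mirror image of the previous bound: moving left subtracts the integral of [G f], so upper bounds
    on [G f] are what is needed. *)
Lemma J_taylor_ge_left f A b t s x : loc_integrable f -> 0 <= A ->
  (b%:E < l)%E -> 0 <= x -> x <= s -> s <= t -> t <= b ->
  (forall z, s <= z -> z <= t -> 0 <= f z) ->
  (forall z, x <= z -> z <= t -> - A <= f z) ->
  - (A * mass b * (s - x)) <= J f x - J f t - (x - t) * G f t.
Proof.
move=> If A0 bl x0 xs st tb f0 fA.
have s0 := le_trans x0 xs; have tl := lt_le_l tb bl.
have sl := lt_le_l st tl.
have Gt y : s <= y -> y <= t -> G f y <= G f t.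
  move=> sy yt; apply: integral_upto_le => //; first exact: le_trans sy.
  by move=> z /ltW yz zt; apply: f0 => //; exact: le_trans yz.
have J1 := @J_le f (G f t) s t If s0 st tl Gt.
have J2 : J f s - J f x <= (G f t + A * mass b) * (s - x).
  apply: J_le => // y xy ys; have y0 := le_trans x0 xy.
  have H1 : - A * (mass s - mass y) <= G f s - G f y.
    apply: integral_upto_ge => // z /ltW yz zs.
    by apply: fA; [exact: le_trans yz|exact: le_trans st].
  have H2 : mass s <= mass b by apply: mass_le => //; exact: le_trans tb.
  have H3 := mass_ge0 y y0.
  have H4 := Gt s (lexx _) st.
  have H5 : A * (mass s - mass y) <= A * mass b by apply: ler_wpM2l; lra.
  lra.
lra.
Qed.

(** If the infimum [v] of [f] on [X] were negative, halving with [A = - v] would give the lower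
    bound [v / 2 > v]. *)
Lemma ge0_of_halving (X : R -> Prop) f B :
  (forall x, X x -> B <= f x) ->
  (forall A, 0 <= A -> (forall x, X x -> - A <= f x) ->
     forall x, X x -> - (A / 2) <= f x) ->
  forall x, X x -> 0 <= f x.
Proof.
move=> fB halve x Xx.
have lbE : has_lbound [set f z | z in X] by exists B => _ [z Xz <-]; exact: fB.
have infx z : X z -> inf [set f z | z in X] <= f z.
  by move=> Xz; apply: ge_inf => //; exists z.
rewrite leNgt; apply/negP => fx0.
have v0 : inf [set f z | z in X] < 0 by exact: le_lt_trans (infx x Xx) fx0.
have : inf [set f z | z in X] / 2 <= inf [set f z | z in X].
  apply: lb_le_inf; first by exists (f x), x.
  move=> _ [z Xz <-].
  have nv0 : 0 <= - inf [set f z | z in X] by rewrite oppr_ge0 ltW.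
  suff lb u : X u -> - - inf [set f z | z in X] <= f u.
    by have := halve _ nv0 lb z Xz; rewrite mulNr opprK.
  by rewrite opprK; exact: infx.
lra.
Qed.

(* On steps so short that [q * mass b * delta <= 1/2], a lower bound [- A] of
   [f] improves to [- A / 2], so [f >= 0] propagates from [t] both ways. *)
Lemma minimum_principle f q a b t : loc_integrable f -> 0 <= q ->
  0 <= a -> a <= t -> t <= b -> (b%:E < l)%E ->
  (forall x, a <= x -> x <= b ->
     q * (J f x - J f t - (x - t) * G f t) <= f x) ->
  forall x, a <= x -> x <= b -> 0 <= f x.
Proof.
move=> If q0 a0 at_ tb bl fq.
have t0 := le_trans a0 at_; have b0 := le_trans t0 tb.
have K0 : 0 <= q * mass b by rewrite mulr_ge0// mass_ge0.
(* The [+ 1] keeps [d] positive when [K = 0]. *)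
set K := q * mass b in K0; pose d := (2 * (K + 1))^-1.
have d0 : 0 < d by rewrite invr_gt0; lra.
have Kd : K * d <= 1 / 2 by rewrite /d ler_pdivrMr; lra.
have [B JB] := @J_bounded f b If b0 bl.
have lb x : a <= x -> x <= b ->
    - (q * (B + B + (b - a) * `|G f t|)) <= f x.
  move=> ax xb; apply: le_trans (fq x ax xb).
  rewrite -mulrN; apply: ler_wpM2l => //.
  have := JB x (le_trans a0 ax) xb; have := JB t t0 tb.
  rewrite !ler_norml => /andP[? ?] /andP[? ?].
  have : `|(x - t) * G f t| <= (b - a) * `|G f t|.
    by rewrite normrM ler_wpM2r// ler_norml; lra.
  by rewrite ler_norml => /andP[? ?]; lra.
(* Induction on the number of steps of length [d] away from [t]. For [n = 0] only [x = t] is left,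
   where the remainder in [fq] vanishes. *)
have main n x : a <= x -> x <= b -> `|x - t| <= n%:R * d -> 0 <= f x.
  elim: n x => [|n IH] x ax xb.
    rewrite mul0r normr_le0 subr_eq0 => /eqP ->.
    by apply: le_trans (fq t at_ tb); rewrite !subrr mul0r subr0 mulr0.
  move=> xn.
  suff : forall x, [/\ a <= x, x <= b & `|x - t| <= n.+1%:R * d] -> 0 <= f x.
    by apply; split.
  apply: ge0_of_halving => [y [ay yb _]|A A0 fA y [ay yb yn]].
    exact: (lb y ay yb).
  have [yn'|yn'] := leP `|y - t| (n%:R * d).
    by apply: le_trans (IH y ay yb yn'); lra.
  have nd0 : 0 <= n%:R * d by rewrite mulr_ge0// ltW.
  have Sn : n.+1%:R * d = n%:R * d + d by rewrite -natr1 mulrDl mul1r.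
  (* Here [w] is the part of the distance from [y] to [t] that exceeds the first [n] steps. *)
  have bound w : 0 <= w -> w <= d ->
      - (A * mass b * w) <= J f y - J f t - (y - t) * G f t -> - (A / 2) <= f y.
    move=> w0 wd H; apply: le_trans (fq y ay yb).
    have := ler_wpM2l q0 H; apply: le_trans.
    have : A * (K * w) <= A * (1 / 2).
      by apply: ler_wpM2l => //; apply: le_trans Kd; apply: ler_wpM2l.
    by rewrite /K; lra.
  move: yn yn'; rewrite Sn; have [ty|ty] := leP t y.
    rewrite ger0_norm ?subr_ge0// => yn yn'.
    apply: (bound (y - (t + n%:R * d))); [lra|lra|].
    apply: J_taylor_ge_right => //; [lra|lra| |].
      move=> z tz zs; apply: IH; [lra|lra|rewrite ger0_norm; lra].
    move=> z tz zs; apply: fA; split; [lra|lra|rewrite ger0_norm ?Sn; lra].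
  rewrite ltr0_norm ?subr_lt0// => yn yn'.
  apply: (bound (t - n%:R * d - y)); [lra|lra|].
  apply: J_taylor_ge_left => //; [lra|lra|lra| |].
    move=> z tz zs; apply: IH; [lra|lra|rewrite ler0_norm; lra].
  move=> z tz zs; apply: fA; split; [lra|lra|rewrite ler0_norm ?Sn; lra].
move=> x ax xb; apply: (main (Num.truncn ((b - a) / d)).+1) => //.
rewrite -ler_pdivrMr//; apply: le_trans (ltW (truncnS_gt _)).
by rewrite ler_pdivrMr// divfK ?gt_eqF// ler_norml; lra.
Qed.

(** The minimum principle with [a = t = 0]: [J f] and [G f] vanish at [0], so the Taylor remainder
    is [J f] itself. *)
Lemma supersolution_ge0 f q : loc_integrable f -> 0 <= q ->
  (forall x, 0 <= x -> (x%:E < l)%E -> q * J f x <= f x) ->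
  forall x, 0 <= x -> (x%:E < l)%E -> 0 <= f x.
Proof.
move=> If q0 fq x x0 xl.
apply: (@minimum_principle f q 0 x 0) => // y y0 yx.
by rewrite J0 integral_upto0 mulr0 !subr0; apply: fq => //; exact: lt_le_l xl.
Qed.

(** * Boundary classification *)

Lemma inner_space0 c : 0 \in inner_space dm l1 l c.
Proof.
rewrite inE /inner_space; have l10 := string_l1_gt0 m_string.
by case: boundary => /=; rewrite ?l_gt0 ?(ltW l10).
Qed.

Lemma state_space0 c : state_space dm l1 l c 0.
Proof.
rewrite /state_space; have l10 := string_l1_gt0 m_string.
case: boundary => /=; rewrite ?l_gt0 ?(ltW l10) ?(ltW l_gt0)//.
by left.
Qed.

Section boundary_classification.
Variable c : R.
Hypotheses (c_gt0 : 0 < c) (c_lt_l1 : (c%:E < l1)%E).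

Let D : set R := [set y | c < y /\ (y%:E < l1)%E].

Let interval_D : is_interval D.
Proof.
move=> x y [cx _] [_ yl] z /andP[xz zy]; split; first exact: lt_le_trans xz.
by apply: le_lt_trans yl; rewrite lee_fin.
Qed.

Let measurable_D : measurable (D : set (measurableTypeR R)).
Proof. exact: is_interval_measurable. Qed.

Let l1_le_l : (l1 <= l)%E := string_l1_le_l m_string.

Let measurable_section (mu : {measure set (measurableTypeR R) -> \bar R}) :
  measurable_fun D (fun y => mu `]c, y[%classic).
Proof.
apply: nondecreasing_emeasurable => // x y _ _ xy.
apply: le_measure; rewrite ?inE//= => z /=.
by rewrite !in_itv/= => /andP[-> /lt_le_trans]; apply.
Qed.

Let section_sub y : D y -> `]c, y[%classic `<=` D.
Proof.
move=> [cy yl] z /=; rewrite in_itv/= => /andP[cz zy]; split => //.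
by apply: lt_trans yl; rewrite lte_fin.
Qed.

(** Serves both [F1] and [F2], which exchange the roles of the two measures: every section lies in
    [D], so the integral is at most [nu D * mu D]. *)
Let iterated_integral_lty (mu nu : {measure set (measurableTypeR R) -> \bar R}) :
  (mu D < +oo)%E -> (nu D < +oo)%E ->
  (\int[mu]_(y in D) nu `]c, y[%classic < +oo)%E.
Proof.
move=> muD nuD; apply: (@le_lt_trans _ _ (\int[mu]_(y in D) (cst (nu D) y))%E).
  apply: ge0_le_integral => //; first exact: measurable_section.
  by move=> y Dy; apply: le_measure; rewrite ?inE//; exact: section_sub.
by rewrite integral_cst// lte_mul_pinfty// ge0_fin_numE.
Qed.

Let lebesgue_D_lty b : l1 = b%:E -> (lebesgue_measure D < +oo)%E.
Proof.
move=> l1b; apply: (@le_lt_trans _ _ (lebesgue_measure `]c, b]%classic)).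
  apply: le_measure; rewrite ?inE//= => y [cy]; rewrite l1b lte_fin => /ltW yb.
  by rewrite /= in_itv/= cy.
by rewrite /= lebesgue_measure_itv/=; case: ifP => _; rewrite ?ltry// -EFinB ltry.
Qed.

Lemma F1_lty b : l1 = b%:E -> (dm D < +oo)%E -> (F1 dm l1 c < +oo)%E.
Proof. by move=> /lebesgue_D_lty lD dD; exact: iterated_integral_lty. Qed.

Lemma F2_lty b : l1 = b%:E -> (dm D < +oo)%E -> (F2 dm l1 c < +oo)%E.
Proof. by move=> /lebesgue_D_lty lD dD; exact: iterated_integral_lty. Qed.

Lemma l1_fin : (l1 < +oo)%E -> exists2 b, c < b & l1 = b%:E.
Proof.
move: c_lt_l1; case: l1 => [b| |]//.
by rewrite lte_fin => cb _; exists b.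
Qed.

(** If [l1 < l], then [m] is still finite at [l1], so [D] has finite mass for both measures and [l1]
    is regular. Hence every non-regular type forces [l1 = l]. *)
Lemma F_lty_of_l1_lt_l : (l1 < l)%E ->
  (F1 dm l1 c < +oo)%E /\ (F2 dm l1 c < +oo)%E.
Proof.
move=> l1l; have [b cb l1b] := l1_fin (lt_le_trans l1l (leey _)).
have dD : (dm D < +oo)%E.
  apply: (@le_lt_trans _ _ (dm `]c, b]%classic)).
    apply: le_measure; rewrite ?inE//= => y [cy]; rewrite l1b lte_fin => /ltW yb.
    by rewrite /= in_itv/= cy.
  by rewrite dm_itv ?ltry// ?ltW// -l1b.
by split; [exact: F1_lty l1b dD|exact: F2_lty l1b dD].
Qed.

(** Near a finite end the integrand of [F2] is bounded below, so finiteness of [F2] bounds [dm]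
    there. Consequently an entrance boundary lies at infinity. *)
Lemma F1_lty_of_F2_lty : (l1 < +oo)%E -> (F2 dm l1 c < +oo)%E ->
  (F1 dm l1 c < +oo)%E.
Proof.
move=> /l1_fin[b cb l1b] F2oo; apply: (F1_lty b l1b).
(* The midpoint keeps away from [c], where the integrand of [F2] degenerates: on []c', b[] it is at
   least [c' - c]. The rest []c, c']] lies below [l] and has finite mass. *)
pose c' := (c + b) / 2; have [cc' c'b] : c < c' /\ c' < b by rewrite /c'; lra.
pose D' : set R := `]c', b[%classic.
have D'D : D' `<=` D.
  move=> y; rewrite /D' /= in_itv/= => /andP[c'y yb].
  by split; rewrite ?l1b ?lte_fin// (lt_trans cc').
have D'oo : (dm D' < +oo)%E.
  rewrite ltey; apply/eqP => dD'.
  suff : ((c' - c)%:E * dm D' <= F2 dm l1 c)%E.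
    rewrite dD' gt0_muley ?lte_fin ?subr_gt0//.
    by move=> /le_lt_trans/(_ F2oo); rewrite ltxx.
  apply: (@le_trans _ _ (\int[dm]_(y in D') lebesgue_measure `]c, y[%classic)%E).
    rewrite -integral_cst//; last exact: measurable_itv.
    apply: ge0_le_integral => //.
    - exact: measurable_itv.
    - by move=> y _; rewrite lee_fin subr_ge0 ltW.
    - by apply: measurable_funS (measurable_section lebesgue_measure).
    - move=> y; rewrite /D' /= in_itv/= => /andP[c'y yb].
      by rewrite lebesgue_measure_itv/= lte_fin (lt_trans cc')// -EFinB lee_fin; lra.
  apply: ge0_subset_integral => //; first exact: measurable_itv.
  exact: measurable_section.
have c'l : (c'%:E < l)%E.
  by apply: lt_le_trans l1_le_l; rewrite l1b lte_fin.
apply: (@le_lt_trans _ _ (dm (`]c, c']%classic `|` D'))).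
  apply: le_measure; rewrite ?inE//=.
    by apply: measurableU; exact: measurable_itv.
  move=> y [cy]; rewrite l1b lte_fin => yb.
  by case: (leP y c') => yc'; [left|right]; rewrite /D' /= in_itv/= ?cy ?yc'.
apply: (@le_lt_trans _ _ (dm `]c, c']%classic + dm D')%E).
  by apply: measureU2; exact: measurable_itv.
by rewrite lte_add_pinfty// dm_itv ?ltry// ?ltW.
Qed.

(** Reduces the six boundary types to two cases. The bound by [l1] in the first serves the strict
    monotonicity of the limit; in the second the resolvent takes its default value [0]. *)
Lemma state_space_cases x : state_space dm l1 l c x -> 0 <= x /\
  ([/\ x \in inner_space dm l1 l c, (x%:E < l)%E & (x%:E <= l1)%E] \/
   x \notin inner_space dm l1 l c /\ x%:E = l).
Proof.
have l1E : ~ ((F1 dm l1 c < +oo)%E /\ (F2 dm l1 c < +oo)%E) -> l1 = l.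
  move=> H; apply/eqP; rewrite eq_le l1_le_l/= leNgt.
  by apply/negP => /F_lty_of_l1_lt_l.
(* Common to the absorbing, exit and natural types, where [I'] is [[0, l[]. *)
have half_open : l1 = l -> 0 <= x -> (x%:E <= l)%E -> 0 <= x /\
    ([/\ x \in [set y | 0 <= y /\ (y%:E < l)%E], (x%:E < l)%E &
         (x%:E <= l1)%E] \/
     x \notin [set y | 0 <= y /\ (y%:E < l)%E] /\ x%:E = l).
  move=> -> x0; rewrite le_eqVlt => /predU1P[xl|xl]; split => //; [right|left].
    by split => //; apply/negP; rewrite inE/= xl ltxx => -[].
  by split => //; [rewrite inE|rewrite xl orbT].
rewrite /state_space /inner_space /boundary.
have [F1oo|F1oo] := ltP (F1 dm l1 c) +oo%E;
  have [F2oo|F2oo] := ltP (F2 dm l1 c) +oo%E.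
- have [l1l|l1l] := ltP l1 l.
    case: eqP => loo /=.
      move=> [x0 xl1]; split => //; left; split => //; first by rewrite inE.
      by rewrite loo ltry.
    move=> [[x0 xl1]|xl].
      split => //; left; split => //; first by rewrite inE.
      exact: le_lt_trans l1l.
    have x0 : 0 <= x by rewrite -lee_fin xl (ltW l_gt0).
    split => //; right; split => //; apply/negP; rewrite inE/= xl => -[_].
    by rewrite leNgt l1l.
  move=> [x0 xl]; apply: half_open => //.
  by apply/eqP; rewrite eq_le l1_le_l.
- move=> [x0 xl]; apply: half_open => //; apply: l1E => -[_].
  by move=> /(le_lt_trans F2oo); rewrite ltxx.
- have l1l : l1 = l.
    by apply: l1E => -[+ _] => /(le_lt_trans F1oo); rewrite ltxx.
  have l1oo : l1 = +oo%E.
    apply/eqP; rewrite -leye_eq leNgt; apply/negP => l1fin.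
    have := F1_lty_of_F2_lty l1fin F2oo.
    by move=> /(le_lt_trans F1oo); rewrite ltxx.
  by move=> /= x0; split => //; left; rewrite -l1l l1oo ltry leey inE.
- move=> [x0 xl]; apply: half_open => //; last exact: ltW.
  by apply: l1E => -[+ _] => /(le_lt_trans F1oo); rewrite ltxx.
Qed.

End boundary_classification.

(** * Bounds on [J 1] and limits at the right end *)

Lemma J1_ge0 x : 0 <= x -> (x%:E < l)%E -> 0 <= J (cst 1) x.
Proof.
move=> x0 xl; rewrite -(J0 (cst 1)); apply: J_ge0_le => //.
exact: loc_integrable_cst.
Qed.

(** [J 1] is the integral of [m], which is at least [mass a] beyond [a]; for [z < a] the left-hand
    side is not positive. *)
Lemma J1_ge a z : 0 <= a -> (a%:E < l)%E -> 0 <= z -> (z%:E < l)%E ->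
  mass a * (z - a) <= J (cst 1) z.
Proof.
move=> a0 al z0 zl; have [az|za] := leP a z; last first.
  by apply: le_trans (J1_ge0 z z0 zl); rewrite mulr_ge0_le0 ?mass_ge0//; lra.
have H : forall y, a <= y -> y <= z -> mass a <= G (cst 1) y.
  move=> y ay yz; have yl := lt_le_l yz zl.
  by rewrite integral_upto1// ?mass_le// (le_trans a0).
have := @J_ge (cst 1) (mass a) a z (loc_integrable_cst 1) a0 az zl H.
by have := J1_ge0 a a0 al; lra.
Qed.

Lemma J_le_J1 f x : loc_integrable f -> 0 <= x -> (x%:E < l)%E ->
  (forall z, 0 <= z -> z <= x -> f z <= f x) -> J f x <= f x * J (cst 1) x.
Proof.
move=> If x0 xl fx; rewrite -J_cst//; apply: J_mono => //.
  exact: loc_integrable_cst.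
by move=> z /ltW z0 zx; exact: fx.
Qed.

(** The [match] is the one in the definition of [H]. A bounded non-decreasing function converges to
    its supremum, whether [l] is finite or not. *)
Lemma lim_to_l (u : R -> R) (C : R) :
  (forall x y, 0 <= x -> x <= y -> (y%:E < l)%E -> u x <= u y) ->
  (forall x, 0 <= x -> (x%:E < l)%E -> u x <= C) ->
  let L : R := match l with
           | b%:E => lim (u x @[x --> b^'-])
           | _ => lim (u x @[x --> +oo])
           end in
  (forall x, 0 <= x -> (x%:E < l)%E -> u x <= L) /\
  (forall C', (forall x, 0 <= x -> (x%:E < l)%E -> u x <= C') -> L <= C').
Proof.
have := l_gt0; case: l => [b|_|//]; [rewrite lte_fin => b0|]; move=> und uC /=.
  have cv : cvg (u x @[x --> b^'-]).
    apply: nondecreasing_at_left_is_cvgr.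
      near=> x => y z; rewrite !in_itv/= => /andP[xy _] /andP[_ zb] yz.
      apply: und => //; rewrite (le_trans _ (ltW xy))//.
      by near: x; exact: nbhs_left_ge.
    near=> x; exists C => _ [y /= + <-]; rewrite in_itv/= => /andP[xy yb].
    apply: uC => //; rewrite (le_trans _ (ltW xy))//.
    by near: x; exact: nbhs_left_ge.
  split=> [x x0|C' uC'].
    rewrite lte_fin => xb; apply: limr_ge => //; near=> y.
    by apply: und => //; [near: y; exact: nbhs_left_ge|rewrite lte_fin].
  apply: limr_le => //; near=> y; apply: uC'; last by rewrite lte_fin.
  by near: y; exact: nbhs_left_ge.
have lty x : (x%:E < +oo)%E := ltry x.
have cv : cvg (u x @[x --> +oo]).
  (* Nothing is known of [u] on negative numbers; truncating at [0] makes it monotone on the whole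
     line. *)
  have cv' : cvg (u (Num.max 0 x) @[x --> +oo]).
    apply: (cvgP (sup (range (fun x => u (Num.max 0 x))))).
    apply: nondecreasing_cvgr => [x y xy|].
      apply: und => //; first by rewrite le_max lexx.
      by rewrite ge_max le_max lexx/= le_max xy orbT.
        by exists C => _ [x _ <-]; apply: uC => //; rewrite le_max lexx.
  have [L cL] := iffLR (cvg_ex _) cv'; apply: (cvgP L); apply: cvg_trans cL.
  apply: near_eq_cvg; near=> x.
  by rewrite max_r//; near: x; exact: nbhs_pinfty_ge.
split=> [x x0 _|C' uC'].
  apply: limr_ge => //; near=> y.
  by apply: und => //; near: y; apply: nbhs_pinfty_ge.
apply: limr_le => //; near=> y; exact: uC'.
Unshelve. all: by end_near. Qed.

(** * Total mass of the string and the constant [pi0] *)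

Local Notation M := (lim (m x @[x --> +oo])).

Lemma cvg_m : cvg (m x @[x --> +oo]).
Proof.
have cv' : cvg (m (Num.max 0 x) @[x --> +oo]).
  apply: nondecreasing_is_cvge => x y xy.
  apply: (string_nondecreasing m_string); first by rewrite le_max lexx.
  by rewrite ge_max le_max lexx/= le_max xy orbT.
have [L cL] := iffLR (cvg_ex _) cv'; apply: (cvgP L); apply: cvg_trans cL.
apply: near_eq_cvg; near=> x.
by rewrite max_r//; near: x; exact: nbhs_pinfty_ge.
Unshelve. all: by end_near. Qed.

Lemma m_le_lim x : 0 <= x -> (m x <= M)%E.
Proof.
move=> x0; apply: lime_ge; first exact: cvg_m.
by near=> y; apply: (string_nondecreasing m_string).
Unshelve. all: by end_near. Qed.

Lemma lim_m_le C : (forall x, 0 <= x -> (m x <= C)%E) -> (M <= C)%E.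
Proof.
move=> mC; apply: lime_le; first exact: cvg_m.
by near=> y; apply: mC.
Unshelve. all: by end_near. Qed.

Lemma exists_mass_gt0 : exists2 a, 0 < a & (a%:E < l)%E /\ 0 < mass a.
Proof.
have [a a0 al1] : exists2 a : R, 0 < a & (a%:E < l1)%E.
  have := string_l1_gt0 m_string; case: l1 => [b|_|//].
    by rewrite lte_fin => b0; exists (b / 2); rewrite ?lte_fin; lra.
  by exists 1; rewrite ?ltry.
exists a => //; have al := lt_le_trans al1 (string_l1_le_l m_string).
split => //; have := string_increasing m_string (lexx 0) a0 al1.
by rewrite (string_at0 m_string) massE ?(ltW a0)// lte_fin.
Qed.

Lemma pi0_fin b : l = b%:E -> pi0 m = 0.
Proof.
move=> lb; rewrite /pi0.
have b0 : 0 < b by have := l_gt0; rewrite lb lte_fin.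
have := @m_le_lim b (ltW b0); rewrite (string_infinite m_string) ?lb//.
by rewrite leye_eq => /eqP ->.
Qed.

Lemma pi0_ge0 : 0 <= pi0 m.
Proof.
rewrite /pi0; have := m_le_lim _ (lexx 0); rewrite (string_at0 m_string).
by case: (lim _) => [r||] //; rewrite lee_fin invr_ge0.
Qed.

Lemma pi0_neq0 : pi0 m != 0 -> l = +oo%E.
Proof.
have := l_gt0; case El : l => [b| |]//.
by rewrite (pi0_fin b El) eqxx.
Qed.

Lemma pi0_neq0_limE : pi0 m != 0 -> M = ((pi0 m)^-1)%:E.
Proof. by rewrite /pi0; case: (lim _) => [r||]; rewrite ?eqxx// invrK. Qed.

Lemma mass_le_pi0 x : 0 <= x -> (x%:E < l)%E -> pi0 m != 0 ->
  mass x <= (pi0 m)^-1.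
Proof.
by move=> x0 xl p0; rewrite -lee_fin -massE// -pi0_neq0_limE// m_le_lim.
Qed.

(** Treats finite and infinite [m(oo)] together: otherwise [m(oo) <= 1 / (pi0 + e)], so [m(oo)] is
    finite and its inverse [pi0] is at least [pi0 + e]. *)
Lemma pi0_approx e : 0 < e -> l = +oo%E ->
  exists2 a, 0 <= a & 0 < mass a /\ (mass a)^-1 <= pi0 m + e.
Proof.
move=> e0 loo; have ml x : (x%:E < l)%E by rewrite loo ltry.
have [a0 a00 [_ ma0]] := exists_mass_gt0.
suff [a aa0 mae] : exists2 a, 0 <= a & (pi0 m + e)^-1 <= mass a.
  have p0e : 0 < pi0 m + e by have := pi0_ge0; lra.
  have ma : 0 < mass a by apply: lt_le_trans mae; rewrite invr_gt0.
  exists a => //; split => //.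
  by rewrite -[leRHS]invrK lef_pV2// posrE invr_gt0.
apply: contrapT => H.
have mle x : 0 <= x -> mass x <= (pi0 m + e)^-1.
  by move=> x0; rewrite leNgt; apply/negP => /ltW ?; apply: H; exists x.
have : (M <= ((pi0 m + e)^-1)%:E)%E.
  by apply: lim_m_le => x x0; rewrite massE// lee_fin mle.
have MM : (0%:E < M)%E.
  apply: lt_le_trans (m_le_lim _ (ltW a00)).
  by rewrite massE ?lte_fin// ltW.
rewrite /pi0; move: MM; case: (lim _) => [r|//|//].
rewrite lte_fin => r0; rewrite lee_fin => rle.
have ri : 0 < r^-1 by rewrite invr_gt0.
have : r * (r^-1 + e) <= 1.
  by rewrite -ler_pdivlMr ?div1r//; lra.
by rewrite mulrDr divff ?gt_eqF//; have := mulr_gt0 r0 e0; lra.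
Qed.

(** * Limits as the rate tends to zero *)

Section resolvent.
Variables phi psi : R -> R -> R.
Hypothesis phi_solves : forall q, 0 < q -> solves dm l (fun=> 1) q (phi q).
Hypothesis psi_solves : forall q, 0 < q -> solves dm l (@scale R) q (psi q).

(** * Estimates on [phi_q] and [psi_q] at a fixed rate *)

Section fixed_rate.
Variable q : R.
Hypothesis q_gt0 : 0 < q.
Local Notation phi_q := (phi q).
Local Notation psi_q := (psi q).

Let q_ge0 : 0 <= q := ltW q_gt0.
Let Iphi : loc_integrable phi_q := proj1 (phi_solves q q_gt0).
Let Ipsi : loc_integrable psi_q := proj1 (psi_solves q q_gt0).
Let I1 : loc_integrable (cst 1) := loc_integrable_cst 1.

Lemma phiE x : 0 <= x -> (x%:E < l)%E -> phi_q x = 1 + q * J phi_q x.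
Proof. exact: (proj2 (phi_solves q q_gt0)). Qed.

Lemma psiE x : 0 <= x -> (x%:E < l)%E -> psi_q x = x + q * J psi_q x.
Proof. exact: (proj2 (psi_solves q q_gt0)). Qed.

Lemma phi0 : phi_q 0 = 1.
Proof. by rewrite phiE ?l_gt0// J0 mulr0 addr0. Qed.

Lemma psi0 : psi_q 0 = 0.
Proof. by rewrite psiE ?l_gt0// J0 mulr0 addr0. Qed.

Lemma phi_ge0 x : 0 <= x -> (x%:E < l)%E -> 0 <= phi_q x.
Proof.
apply: (@supersolution_ge0 phi_q q) => // {}x x0 xl.
by rewrite phiE//; lra.
Qed.

Lemma psi_ge0 x : 0 <= x -> (x%:E < l)%E -> 0 <= psi_q x.
Proof.
apply: (@supersolution_ge0 psi_q q) => // {}x x0 xl.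
by rewrite [leRHS]psiE//; lra.
Qed.

Lemma phi_le x y : 0 <= x -> x <= y -> (y%:E < l)%E -> phi_q x <= phi_q y.
Proof.
move=> x0 xy yl; have y0 := le_trans x0 xy; have xl := lt_le_l xy yl.
rewrite phiE// [leRHS]phiE// lerD2l ler_wpM2l// J_ge0_le// => z /ltW z0 zy.
by apply: phi_ge0 => //; exact: lt_le_l yl.
Qed.

Lemma psi_le x y : 0 <= x -> x <= y -> (y%:E < l)%E -> psi_q x <= psi_q y.
Proof.
move=> x0 xy yl; have y0 := le_trans x0 xy; have xl := lt_le_l xy yl.
rewrite psiE// [leRHS]psiE// lerD// ler_wpM2l// J_ge0_le// => z /ltW z0 zy.
by apply: psi_ge0 => //; exact: lt_le_l yl.
Qed.

Lemma phi_ge1 x : 0 <= x -> (x%:E < l)%E -> 1 <= phi_q x.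
Proof. by move=> x0 xl; rewrite -phi0; exact: phi_le. Qed.

Lemma phi_gt0 x : 0 <= x -> (x%:E < l)%E -> 0 < phi_q x.
Proof. by move=> x0 xl; apply: lt_le_trans (phi_ge1 x x0 xl). Qed.

Lemma J_phi_le x : 0 <= x -> (x%:E < l)%E -> J phi_q x <= phi_q x * J (cst 1) x.
Proof. by move=> x0 xl; apply: J_le_J1 => // z z0 zx; exact: phi_le. Qed.

Lemma J_phi_ge x : 0 <= x -> (x%:E < l)%E -> J (cst 1) x <= J phi_q x.
Proof.
move=> x0 xl; apply: J_mono => // z /ltW z0 zx.
by apply: phi_ge1 => //; exact: lt_le_l xl.
Qed.

Lemma J_psi_le x : 0 <= x -> (x%:E < l)%E -> J psi_q x <= psi_q x * J (cst 1) x.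
Proof. by move=> x0 xl; apply: J_le_J1 => // z z0 zx; exact: psi_le. Qed.

Lemma psi_ge x : 0 <= x -> (x%:E < l)%E -> x <= psi_q x.
Proof.
move=> x0 xl; rewrite psiE// lerDl mulr_ge0// -(J0 psi_q) J_ge0_le//.
by move=> z /ltW z0 zx; apply: psi_ge0 => //; exact: lt_le_l xl.
Qed.

(** Monotonicity gives [J phi <= phi x * J 1] on [[0, x]]. The product form avoids any smallness
    condition on [q]. *)
Lemma phi_le_inv x : 0 <= x -> (x%:E < l)%E ->
  phi_q x * (1 - q * J (cst 1) x) <= 1.
Proof.
move=> x0 xl; have := ler_wpM2l q_ge0 (J_phi_le x x0 xl).
by have := phiE x x0 xl; lra.
Qed.

Lemma psi_le_inv x : 0 <= x -> (x%:E < l)%E ->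
  psi_q x * (1 - q * J (cst 1) x) <= x.
Proof.
move=> x0 xl; have := ler_wpM2l q_ge0 (J_psi_le x x0 xl).
by have := psiE x x0 xl; lra.
Qed.

(* With [k = psi x / phi x] the function [f = psi - k phi] vanishes at [x] and
   is negative at [0]; its right slope at [x] is nonnegative, since otherwise
   the minimum principle run backwards from [x] would give [f 0 >= 0]. *)
Lemma psi_phi_nondecreasing x y : 0 <= x -> x <= y -> (y%:E < l)%E ->
  psi_q x / phi_q x <= psi_q y / phi_q y.
Proof.
rewrite le_eqVlt => /predU1P[<- xy yl|x0 xy yl].
  by rewrite psi0 mul0r divr_ge0// ?psi_ge0 ?phi_ge0.
have y0 := le_trans (ltW x0) xy; have xl := lt_le_l xy yl.
have px := phi_gt0 x (ltW x0) xl; have py := phi_gt0 y y0 yl.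
set k := psi_q x / phi_q x.
have k0 : 0 < k by rewrite divr_gt0//; apply: lt_le_trans (psi_ge x (ltW x0) xl).
pose f z := psi_q z + - k * phi_q z.
have If : loc_integrable f := loc_integrableD psi_q phi_q (- k) Ipsi Iphi.
have fx : f x = 0 by rewrite /f /k mulNr divfK ?subrr// gt_eqF.
have fE z : 0 <= z -> (z%:E < l)%E -> f z = z - k + q * J f z.
  by move=> z0 zl; rewrite /f JD// psiE// [in LHS]phiE//; lra.
have f0 : f 0 < 0 by rewrite fE ?l_gt0// J0; lra.
suff : 0 <= f y by rewrite /f mulNr subr_ge0 ler_pdivlMr.
have D0 : 0 <= 1 + q * G f x.
  rewrite leNgt; apply/negP => D0.
  suff : 0 <= f 0 by lra.
  apply: (@minimum_principle f q 0 x x If q_ge0) => //; rewrite ?(ltW x0)//.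
  move=> z z0 zx; have zl := lt_le_l zx xl.
  rewrite [leRHS](fE z z0 zl).
  have := fE x (ltW x0) xl; rewrite fx.
  have : 0 <= (1 + q * G f x) * (z - x) by apply: mulr_le0; lra.
  by lra.
apply: (@minimum_principle f q x y x If q_ge0) => //; rewrite ?(ltW x0)//.
move=> z xz zy; have zl := lt_le_l zy yl; have z0 := le_trans (ltW x0) xz.
rewrite [leRHS](fE z z0 zl).
have := fE x (ltW x0) xl; rewrite fx.
have : 0 <= (1 + q * G f x) * (z - x) by apply: mulr_ge0; lra.
by lra.
Qed.

(** The function [f = L phi - psi] satisfies [f - q J f = L - x >= 0]. *)
Lemma psi_le_phi L : (forall x, 0 <= x -> (x%:E < l)%E -> x <= L) ->
  forall x, 0 <= x -> (x%:E < l)%E -> psi_q x <= L * phi_q x.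
Proof.
move=> xL x x0 xl.
(* The zero term gives the combination the nested shape [f + k * f'] required by [loc_integrableD]
   and [JD]. *)
suff : 0 <= (cst 0 x + L * phi_q x) + (-1) * psi_q x by rewrite /cst/=; lra.
have I0 := loc_integrable_cst 0.
have ILphi := loc_integrableD (cst 0) phi_q L I0 Iphi.
apply: (@supersolution_ge0 (fun z => (cst 0 z + L * phi_q z) + (-1) * psi_q z) q
    _ q_ge0 _ x x0 xl) => [|z z0 zl].
  exact: (loc_integrableD _ psi_q (-1) ILphi Ipsi).
have -> := JD _ psi_q (-1) z ILphi Ipsi z0 zl.
have -> := JD (cst 0) phi_q L z I0 Iphi z0 zl.
rewrite J_cst// [in leRHS]psiE// [in leRHS]phiE// /cst/=.
by have := xL z z0 zl; lra.
Qed.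

(** For [f = -1 + (1 + K) phi - N psi] one finds [f - q J f = q (J 1 - mass a * (x - a)) >= 0]; the
    constant [-1] is what produces [q J 1]. *)
Lemma psi_le_phi_mass a x : 0 <= a -> (a%:E < l)%E -> 0 <= x -> (x%:E < l)%E ->
  q * mass a * psi_q x <= (1 + q * mass a * a) * phi_q x.
Proof.
move=> a0 al x0 xl; set K := q * mass a * a; set N := q * mass a.
suff : 0 <= (cst (-1) x + (1 + K) * phi_q x) + (- N) * psi_q x.
  by have := phi_ge0 x x0 xl; rewrite /cst/=; lra.
have IN1 := loc_integrable_cst (-1).
have IK := loc_integrableD (cst (-1)) phi_q (1 + K) IN1 Iphi.
apply: (@supersolution_ge0
    (fun z => (cst (-1) z + (1 + K) * phi_q z) + (- N) * psi_q z) q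
    _ q_ge0 _ x x0 xl) => [|z z0 zl].
  exact: (loc_integrableD _ psi_q (- N) IK Ipsi).
have -> := JD _ psi_q (- N) z IK Ipsi z0 zl.
have -> := JD (cst (-1)) phi_q (1 + K) z IN1 Iphi z0 zl.
rewrite J_cst// [in leRHS]psiE// [in leRHS]phiE// /cst/=.
by have := ler_wpM2l q_ge0 (J1_ge a z a0 al z0 zl); rewrite /K /N; lra.
Qed.

(** For [f = 1 - phi + N psi] one finds [f - q J f = q (M x - J 1)], nonnegative because
    [m <= M]. *)
Lemma phi_le_psi_mass M : (forall x, 0 <= x -> (x%:E < l)%E -> mass x <= M) ->
  forall x, 0 <= x -> (x%:E < l)%E -> phi_q x - 1 <= q * M * psi_q x.
Proof.
move=> mM x x0 xl; set N := q * M.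
suff : 0 <= (cst 1 x + (-1) * phi_q x) + N * psi_q x by rewrite /cst/=; lra.
have IK := loc_integrableD (cst 1) phi_q (-1) I1 Iphi.
apply: (@supersolution_ge0 (fun z => (cst 1 z + (-1) * phi_q z) + N * psi_q z) q
    _ q_ge0 _ x x0 xl) => [|z z0 zl].
  exact: (loc_integrableD _ psi_q N IK Ipsi).
have -> := JD _ psi_q N z IK Ipsi z0 zl.
have -> := JD (cst 1) phi_q (-1) z I1 Iphi z0 zl.
rewrite [in leRHS]psiE// [in leRHS]phiE// /cst/=.
suff H : J (cst 1) z <= M * z by have := ler_wpM2l q_ge0 H; rewrite /N; lra.
have H : forall y, 0 <= y -> y <= z -> G (cst 1) y <= M.
  move=> y y0 yz; have yl := lt_le_l yz zl.
  by rewrite integral_upto1// mM.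
by have := @J_le (cst 1) M 0 z I1 (lexx _) z0 zl H; rewrite J0; lra.
Qed.

(** The previous bound divided by [M phi]; the term [1 / phi] is made small later by taking [x]
    large. *)
Lemma psi_mass_ge M : 0 < M ->
  (forall x, 0 <= x -> (x%:E < l)%E -> mass x <= M) ->
  forall x, 0 <= x -> (x%:E < l)%E ->
  (1 - (phi_q x)^-1) / M <= q * (psi_q x / phi_q x).
Proof.
move=> M0 mM x x0 xl; have p0 := phi_gt0 x x0 xl.
rewrite ler_pdivrMr// -subr_ge0.
have -> : q * (psi_q x / phi_q x) * M - (1 - (phi_q x)^-1) =
  (q * M * psi_q x - (phi_q x - 1)) / phi_q x by field; rewrite gt_eqF.
by rewrite divr_ge0 ?(ltW p0)// subr_ge0 phi_le_psi_mass.
Qed.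

End fixed_rate.

(** * Bounds on [H] *)

Local Notation H := (H l phi psi).

Lemma psi_phi_bounded q : 0 < q -> exists C, forall x, 0 <= x -> (x%:E < l)%E ->
  psi q x / phi q x <= C.
Proof.
move=> q0.
have [a a0 [al ma]] := exists_mass_gt0.
exists ((1 + q * mass a * a) / (q * mass a)) => x x0 xl.
have px := phi_gt0 q q0 x x0 xl.
rewrite ler_pdivrMr// mulrAC ler_pdivlMr ?mulr_gt0// mulrC.
exact: (psi_le_phi_mass q q0 a x (ltW a0) al x0 xl).
Qed.

(** All estimates of [H q] below rest on this supremum property, never on the limit itself. *)
Lemma H_bounds q : 0 < q ->
  (forall x, 0 <= x -> (x%:E < l)%E -> psi q x / phi q x <= H q) /\
  (forall C, (forall x, 0 <= x -> (x%:E < l)%E -> psi q x / phi q x <= C) ->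
     H q <= C).
Proof.
move=> q0; have [C uC] := psi_phi_bounded q q0.
apply: (lim_to_l (fun x => psi q x / phi q x) C) => //.
exact: psi_phi_nondecreasing.
Qed.

Lemma H_gt0 q : 0 < q -> 0 < H q.
Proof.
move=> q0; have [a a0 [al _]] := exists_mass_gt0.
apply: lt_le_trans ((H_bounds q q0).1 a (ltW a0) al).
rewrite divr_gt0 ?(phi_gt0 q q0 a (ltW a0) al)//.
exact: lt_le_trans (psi_ge q q0 a (ltW a0) al).
Qed.

Lemma H_le_l q b : 0 < q -> l = b%:E -> H q <= b.
Proof.
move=> q0 lb; apply: (H_bounds q q0).2 => x x0 xl.
have px := phi_gt0 q q0 x x0 xl.
rewrite ler_pdivrMr//.
apply: (psi_le_phi q q0) => // y _.
by rewrite lb lte_fin => /ltW.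
Qed.

(** Combines [psi >= x] with [1 / phi >= 1 - q J 1]. *)
Lemma H_ge q x : 0 < q -> 0 <= x -> (x%:E < l)%E ->
  x * (1 - q * J (cst 1) x) <= H q.
Proof.
move=> q0 x0 xl; apply: le_trans ((H_bounds q q0).1 x x0 xl).
have px := phi_gt0 q q0 x x0 xl.
have pi := phi_le_inv q q0 x x0 xl.
have sx := psi_ge q q0 x x0 xl.
rewrite ler_pdivlMr//; apply: le_trans sx.
rewrite -mulrA -[leRHS]mulr1; apply: ler_wpM2l => //.
by rewrite mulrC.
Qed.

Lemma qH_le q a : 0 < q -> 0 <= a -> (a%:E < l)%E -> 0 < mass a ->
  q * H q <= (mass a)^-1 + q * a.
Proof.
move=> q0 a0 al ma; have qm := mulr_gt0 q0 ma.
rewrite -ler_pdivlMl//; apply: (H_bounds q q0).2 => x x0 xl.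
have px := phi_gt0 q q0 x x0 xl.
have P := psi_le_phi_mass q q0
  a x a0 al x0 xl.
rewrite ler_pdivrMr// (_ : q^-1 * _ * _ =
    (1 + q * mass a * a) * phi q x / (q * mass a)); last first.
  by field; rewrite !gt_eqF.
by rewrite ler_pdivlMr// mulrC.
Qed.

Lemma pi0_le_qH q : 0 < q -> pi0 m <= q * H q.
Proof.
move=> q0; have [->|p0] := eqVneq (pi0 m) 0.
  by rewrite mulr_ge0 ?ltW// H_gt0.
have pi_gt0 : 0 < pi0 m by rewrite lt_neqAle eq_sym p0 pi0_ge0.
have loo := pi0_neq0 p0.
have lty x : (x%:E < l)%E by rewrite loo ltry.
have [a a0 [al ma]] := exists_mass_gt0.
rewrite leNgt; apply/negP => qHlt.
(* Suppose [q H < pi0], with relative gap [e]. The point [x] is chosen so that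
   [q * mass a * (x - a) = 1 / e], whence [phi x > 1 / e]; then [1 - 1 / phi x <= q H / pi0 = 1 - e]
   is contradictory. *)
pose e := 1 - q * H q / pi0 m.
have e0 : 0 < e by rewrite /e subr_gt0 ltr_pdivrMr ?mul1r.
pose x := a + (e * q * mass a)^-1.
have eqm : 0 < (e * q * mass a)^-1 by rewrite invr_gt0 !mulr_gt0.
have x0 : 0 <= x by rewrite /x; lra.
have px : e^-1 < phi q x.
  rewrite (phiE q q0 x x0 (lty x)).
  have := J_phi_ge q q0 x x0 (lty x).
  have := J1_ge a x (ltW a0) al x0 (lty x).
  move=> h1 h2; have := ler_wpM2l (ltW q0) (le_trans h1 h2).
  have -> : q * (mass a * (x - a)) = e^-1.
    by rewrite /x addrAC subrr add0r; field; rewrite !gt_eqF.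
  lra.
have pp := phi_gt0 q q0 x x0 (lty x).
have pxe : (phi q x)^-1 < e.
  by rewrite -div1r ltr_pdivrMr// mulrC -ltr_pdivrMr// div1r.
have Mp : 0 < (pi0 m)^-1 by rewrite invr_gt0.
have := psi_mass_ge q q0 _ Mp
  (fun z z0 zl => mass_le_pi0 z z0 zl p0) x x0 (lty x).
rewrite invrK => P1.
have := ler_wpM2l (ltW q0) ((H_bounds q q0).1 x x0 (lty x)).
move=> /(le_trans P1); rewrite -ler_pdivlMr//.
by rewrite leNgt => /negP; apply; rewrite /e in pxe; lra.
Qed.

Lemma l_cases : l = +oo%E \/ exists2 b, 0 < b & l = b%:E.
Proof.
have := l_gt0; case: l => [b| |]//; last by left.
by rewrite lte_fin => b0; right; exists b.
Qed.

(** * Convergence of [q H(q)], [H(q)], [psi_q] and [J phi_q] *)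

Lemma cvg_at_right0 (f : R -> R) A :
  (forall e : R, 0 < e -> exists2 d : R, 0 < d &
     forall q, 0 < q -> q <= d -> `|A - f q| <= e) ->
  f q @[q --> 0^'+] --> A.
Proof.
move=> fA; apply/cvgrPdist_le => e e0; have [d d0 fd] := fA e e0.
near=> q; apply: fd; near: q; [exact: nbhs_right_gt|exact: nbhs_right_le].
Unshelve. all: by end_near. Qed.

Lemma cvg_qH : q * H q @[q --> 0^'+] --> pi0 m.
Proof.
apply: cvg_at_right0 => e e0; have [El|[b b0 El]] := l_cases.
(* In [q H <= 1 / mass a + q a], the choice of [a] costs [e / 2], and then [q] is taken so small
   that [q a <= e / 2]. *)
- have [a a0 [ma mae]] := pi0_approx (e / 2) ltac:(lra) El.
  exists (e / (2 * (a + 1))) => [|q q0]; first by rewrite divr_gt0//; lra.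
  rewrite ler_pdivlMr; last lra.
  move=> qa; rewrite distrC ger0_norm ?subr_ge0 ?pi0_le_qH//.
  by have := qH_le q a q0 a0 ltac:(by rewrite El ltry) ma; lra.
- exists (e / b) => [|q q0]; first by rewrite divr_gt0.
  rewrite ler_pdivlMr// (pi0_fin b El) sub0r normrN ger0_norm; last first.
    by rewrite mulr_ge0 ?ltW// H_gt0.
  by apply: le_trans; apply: ler_wpM2l; [exact: ltW|exact: H_le_l].
Qed.

Lemma cvg_H_fin b : l = b%:E -> H q @[q --> 0^'+] --> b.
Proof.
move=> El; have b0 : 0 < b by have := l_gt0; rewrite El lte_fin.
apply: cvg_at_right0 => e e0.
(* A point of [[0, b[] within [e / 2] of [b]; the other [e / 2] absorbs [q * x * J 1] in [H_ge]. *)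
pose x := Num.max 0 (b - e / 2).
have x0 : 0 <= x by rewrite le_max lexx.
have xl : (x%:E < l)%E by rewrite El lte_fin gt_max b0/=; lra.
have bx : b - e / 2 <= x by rewrite le_max lexx orbT.
have J10 := J1_ge0 x x0 xl; have xJ0 := mulr_ge0 x0 J10.
exists (e / (2 * (x * J (cst 1) x + 1))) => [|q q0].
  by rewrite divr_gt0//; lra.
rewrite ler_pdivlMr; last lra.
move=> qa; rewrite ger0_norm ?subr_ge0 ?(H_le_l q b)//.
by have := H_ge q x q0 x0 xl; lra.
Qed.

Lemma cvg_psi x : 0 <= x -> (x%:E < l)%E -> psi q x @[q --> 0^'+] --> x.
Proof.
move=> x0 xl; apply: cvg_at_right0 => e e0.
have J10 := J1_ge0 x x0 xl; have xJ0 := mulr_ge0 x0 J10.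
set K := J (cst 1) x in J10 xJ0 *.
(* The first bound gives [q K <= 1 / 2], hence [psi <= 2 x]; the second then makes
   [psi - x <= q K psi <= 2 q x K] at most [e]. *)
exists (Num.min ((2 * (K + 1))^-1) (e / (2 * (x * K + 1)))).
  by rewrite lt_min invr_gt0 divr_gt0//; lra.
move=> q q0; rewrite le_min => /andP[].
rewrite -div1r ler_pdivlMr; last lra.
rewrite ler_pdivlMr; last lra.
move=> qK qx.
have := psi_le_inv q q0 x x0 xl; rewrite -/K.
have := psi_ge q q0 x x0 xl.
set p := psi q x => xp pK; rewrite distrC ger0_norm ?subr_ge0//.
have h1 : 0 <= p * (1 / 2 - q * K) by apply: mulr_ge0; lra.
have h2 : 0 <= q * K * (2 * x - p).
  by apply: mulr_ge0; [apply: mulr_ge0|]; lra.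
lra.
Qed.

Lemma cvg_J_phi x : 0 <= x -> (x%:E < l)%E ->
  J (phi q) x @[q --> 0^'+] --> J (cst 1) x.
Proof.
move=> x0 xl; apply: cvg_at_right0 => e e0.
have K0 := J1_ge0 x x0 xl; have KK0 := mulr_ge0 K0 K0.
(* As before, [q K <= 1 / 2] gives [phi <= 2], and then [J phi - K <= K (phi - 1) <= 2 q K^2 <= e],
   where [K = J 1]. *)
exists (Num.min ((2 * (J (cst 1) x + 1))^-1)
    (e / (2 * (J (cst 1) x * J (cst 1) x + 1)))).
  by rewrite lt_min invr_gt0 divr_gt0//; lra.
move=> q q0; rewrite le_min => /andP[].
rewrite -div1r ler_pdivlMr; last lra.
rewrite ler_pdivlMr; last lra.
move=> qK qx.
have := phi_le_inv q q0 x x0 xl.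
have := phi_ge1 q q0 x x0 xl.
have := J_phi_le q q0 x x0 xl.
have := J_phi_ge q q0 x x0 xl.
set p := phi q x; set K := J (cst 1) x in K0 KK0 qK qx * => KJ Jp p1 pK.
rewrite distrC ger0_norm ?subr_ge0//.
have h1 : 0 <= p * (1 / 2 - q * K) by apply: mulr_ge0; lra.
have h3 : 0 <= K * (1 - p * (1 - q * K)) by apply: mulr_ge0; lra.
have h2 : 0 <= q * (K * K) * (2 - p).
  by apply: mulr_ge0; [apply: mulr_ge0|]; lra.
lra.
Qed.

(** * The limit of [h_q] and its properties *)

Section excursion_limit.
Variable c : R.
Hypotheses (c_gt0 : 0 < c) (c_lt_l1 : (c%:E < l1)%E).
Local Notation I := (state_space dm l1 l c).
Local Notation h := (h dm l1 l c phi psi).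
Local Notation h0 := (h0 dm l1 l c phi psi).

Lemma resolvent00 q : 0 < q -> resolvent dm l1 l c phi psi q 0 0 = H q.
Proof.
move=> q0; rewrite /resolvent inner_space0 minxx maxxx /rho.
by rewrite (phi0 q q0) (psi0 q q0) mul0r subr0 !mulr1.
Qed.

(** Substituting [phi = 1 + q J phi] in [H (1 - phi) + psi] leaves [H] only in the product [q H],
    whose limit is known for finite and infinite [l] alike. *)
Lemma h_inner q x : 0 < q -> x \in inner_space dm l1 l c -> 0 <= x ->
  (x%:E < l)%E -> h q x = psi q x - q * H q * J (phi q) x.
Proof.
move=> q0 xI x0 xl; rewrite /Defs.h resolvent00// /resolvent xI inner_space0 andbT.
rewrite min_r// max_l// /rho (phi0 q q0) (phiE q q0 x x0 xl).
by field; rewrite gt_eqF// H_gt0.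
Qed.

Lemma h_end q x : 0 < q -> x \notin inner_space dm l1 l c -> h q x = H q.
Proof.
by move=> q0 xI; rewrite /Defs.h resolvent00// /resolvent (negbTE xI) subr0.
Qed.

(** Below [l], [J 1] is the integral of [m] because [m 0 = 0]; the case split in [g] disappears
    since the product vanishes with [pi0]. *)
Lemma gE x : 0 <= x -> (x%:E < l)%E -> g m x = pi0 m * J (cst 1) x.
Proof.
move=> x0 xl; rewrite /g; case: eqP => [->|_]; first by rewrite mul0r.
congr (_ * _); apply: eq_Rintegral => y; rewrite inE/= in_itv/= => /andP[y0 yx].
exact: (esym (integral_upto1 y y0 (lt_le_l yx xl))).
Qed.

Lemma cvg_h x : I x -> h q x @[q --> 0^'+] --> x - g m x.
Proof.
move=> /(state_space_cases c c_gt0 c_lt_l1)[x0 [[xI xl _]|[xI xl]]].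
  rewrite gE//.
  apply: cvg_trans
    (cvgB (cvg_psi x x0 xl) (cvgM cvg_qH (cvg_J_phi x x0 xl))).
  apply: near_eq_cvg; near=> q; apply/esym.
  by apply: h_inner => //; near: q; exact: nbhs_right_gt.
(* At [x = l] the end is finite, so [pi0 = 0] and [g = 0], while [h q x = H q] tends to [l]. *)
rewrite /g (pi0_fin x)// eqxx subr0.
apply: cvg_trans (cvg_H_fin x (esym xl)); apply: near_eq_cvg; near=> q; apply/esym.
by apply: h_end => //; near: q; exact: nbhs_right_gt.
Unshelve. all: by end_near. Qed.

Lemma h0E x : I x -> h0 x = x - g m x.
Proof. by move=> Ix; apply/cvg_lim => //; exact: cvg_h. Qed.

Lemma state_space_ge0 x : I x -> 0 <= x.
Proof. by case/(state_space_cases c c_gt0 c_lt_l1). Qed.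

(* Below the end [l'] the string is strictly increasing, hence
   [m < m(oo) = 1 / pi0] there and [g] has slope less than 1. *)
Lemma g_increment x y : I x -> I y -> x < y ->
  0 <= g m y - g m x /\ g m y - g m x < y - x.
Proof.
move=> Ix Iy xy; have [p0|p0] := eqVneq (pi0 m) 0.
  by rewrite /g p0 eqxx subrr subr_gt0.
have loo := pi0_neq0 p0; have ml z : (z%:E < l)%E by rewrite loo ltry.
have pp : 0 < pi0 m by rewrite lt_neqAle eq_sym p0 pi0_ge0.
have x0 := state_space_ge0 x Ix; have y0 := state_space_ge0 y Iy.
have yl1 : (y%:E <= l1)%E.
  by case: (state_space_cases c c_gt0 c_lt_l1 y Iy) => _ [[]|[_]]//; rewrite loo.
(* As [z < w < y <= l1], one has [m z < m w <= 1 / pi0]. So [m] stays below [m z < 1 / pi0] on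
   [[x, z]], which gives the strict inequality, and is at most [1 / pi0] on [[z, y]]. *)
pose z := (x + y) / 2; pose w := (z + y) / 2.
have z0 : 0 <= z by rewrite /z; lra.
have zy : z <= y by rewrite /z; lra.
have xz : x <= z by rewrite /z; lra.
have w0 : 0 <= w by rewrite /w; lra.
have I1 := loc_integrable_cst 1.
have mz : mass z < (pi0 m)^-1.
  apply: lt_le_trans (mass_le_pi0 w w0 (ml w) p0).
  rewrite -lte_fin -!massE//; apply: (string_increasing m_string) => //.
    by rewrite /w /z; lra.
  by apply: lt_le_trans yl1; rewrite lte_fin /w /z; lra.
have J1 := J_le (cst 1) (mass z) x z I1 x0 xz (ml z).
have J2 := J_le (cst 1) (pi0 m)^-1 z y I1 z0 zy (ml y).
have /J1 {}J1 : forall u, x <= u -> u <= z -> G (cst 1) u <= mass z.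
  move=> u xu uz; have u0 := le_trans x0 xu.
  by rewrite integral_upto1// mass_le.
have /J2 {}J2 : forall u, z <= u -> u <= y -> G (cst 1) u <= (pi0 m)^-1.
  move=> u zu uy; have u0 := le_trans z0 zu.
  by rewrite integral_upto1// mass_le_pi0.
have J3 := J_ge0_le (cst 1) x y I1 x0 (ltW xy) (ml y) (fun _ _ _ => ler01).
rewrite !gE// -mulrBr; split; first by rewrite mulr_ge0 ?pi0_ge0// subr_ge0.
rewrite -ltr_pdivlMl//.
have : mass z * (z - x) < (pi0 m)^-1 * (z - x).
  by rewrite ltr_pM2r// subr_gt0 /z; lra.
lra.
Qed.

Lemma h0_increasing x y : I x -> I y -> x < y -> h0 x < h0 y.
Proof.
move=> Ix Iy xy; rewrite !h0E//.
by have [] := g_increment x y Ix Iy xy; lra.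
Qed.

Lemma h0_0 : h0 0 = 0.
Proof.
rewrite h0E; last exact: state_space0.
by rewrite gE ?l_gt0// J0 mulr0 subr0.
Qed.

(** For [x < y] the increment of [h0] is positive, and at most [y - x] because [g] does not
    decrease. Continuity follows on all of [I], the isolated point [l] of the elastic case
    included. *)
Lemma h0_lipschitz x y : I x -> I y -> `|h0 x - h0 y| <= `|x - y|.
Proof.
wlog xy : x y / x <= y.
  move=> W Ix Iy; have [xy|/ltW yx] := leP x y; first exact: W.
  by rewrite distrC [leRHS]distrC; exact: W.
move=> Ix Iy; move: xy; rewrite le_eqVlt => /predU1P[->|xy].
  by rewrite !subrr.
have [g0 g1] := g_increment x y Ix Iy xy.
have := h0_increasing x y Ix Iy xy.
rewrite distrC [leRHS]distrC !h0E// => hh.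
rewrite !ger0_norm; lra.
Qed.

Lemma h0_continuous : {within I, continuous h0}.
Proof.
apply/subspace_continuousP => x Ix; apply/cvgrPdist_le => e e0.
near=> y; apply: (le_trans (h0_lipschitz x y Ix _)).
  by near: y; exact: withinT.
near: y; apply: cvg_within; apply/nbhs_ballP; exists e => //= y.
by rewrite /ball/= => /ltW.
Unshelve. all: by end_near. Qed.

End excursion_limit.

End resolvent.

End stieltjes_operators.

Theorem theorem4p1 (R : realType) (m : R -> \bar R)
    (dm : {measure set (measurableTypeR R) -> \bar R})
    (l1 l : \bar R) (c : R) (phi psi : R -> R -> R)
    (m_string : is_string m l1 l)
    (dm_stieltjes : is_stieltjes m l dm)
    (c_gt0 : 0 < c) (c_lt_l1 : (c%:E < l1)%E)
    (phi_solves : forall q, 0 < q -> solves dm l (fun=> 1) q (phi q))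
    (psi_solves : forall q, 0 < q -> solves dm l (@scale R) q (psi q)) :
  let I := state_space dm l1 l c in
  let h_ := h dm l1 l c phi psi in
  let h0_ := h0 dm l1 l c phi psi in
  (q * H l phi psi q @[q --> 0^'+] --> pi0 m) /\
  (forall x, I x ->
     cvg (h_ q x @[q --> 0^'+]) /\ h0_ x = scale x - g m x) /\
  {within I, continuous h0_} /\
  (forall x y, I x -> I y -> x < y -> h0_ x < h0_ y) /\
  (forall x, I x -> x != 0 -> 0 < h0_ x) /\
  h0_ 0 = 0 /\
  (pi0 m = 0 -> forall x, I x -> h0_ x = scale x).
Proof.
move=> I h_ h0_.
have h0E x : I x -> h0_ x = x - g m x.
  exact: (h0E R m dm l1 l m_string dm_stieltjes).
have h0_0 : h0_ 0 = 0 by exact: (h0_0 R m dm l1 l m_string dm_stieltjes).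
have h0_incr x y : I x -> I y -> x < y -> h0_ x < h0_ y.
  exact: (h0_increasing R m dm l1 l m_string dm_stieltjes).
have Ige0 x : I x -> 0 <= x.
  exact: (state_space_ge0 R m dm l1 l m_string dm_stieltjes).
have I0 : I 0 by exact: (state_space0 R m dm l1 l m_string).
split; first exact: (cvg_qH R m dm l1 l m_string dm_stieltjes).
split.
  move=> x Ix; split; last exact: h0E.
  apply: (cvgP (x - g m x)).
  exact: (cvg_h R m dm l1 l m_string dm_stieltjes).
split; first exact: (h0_continuous R m dm l1 l m_string dm_stieltjes).
split => //; split.
  by move=> x Ix x0; rewrite -h0_0 h0_incr// lt_neqAle eq_sym x0 Ige0.
split => // p0 x Ix.
by rewrite h0E// /g p0 eqxx subr0.
Qed.
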